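(* Let $D$ be a pre-divergence on a Polish space $\mathcal{X}$, $c$ a cost function, and $\mu,\nu\in\mathcal{P}(\mathcal{X})$. If the map $P\mapsto D(P\|\mu)$ is lower semicontinuous and has compact sublevel sets (i.e. $\{P:D(P\|\mu)\leq M\}$ is compact for every $M\in\mathbb{R}$), then there exists $\eta_*\in\mathcal{P}(\mathcal{X})$ with \[D^c(\nu\|\mu)=D(\eta_*\|\mu)+C(\eta_*,\nu).\] If in addition $P\mapsto D(P\|\mu)$ is strictly convex on the set where it is finite and $D^c(\nu\|\mu)<\infty$, then this $\eta_*$ is unique.
   Context: $\mathcal{P}(\mathcal{X})$ is the set of Borel probability measures on the Polish space $\mathcal{X}$ with the weak (Prokhorov) topology. A pre-divergence is $D:\mathcal{P}(\mathcal{X})\times\mathcal{P}(\mathcal{X})\to[0,\infty]$ with $D(\mu\|\mu)=0$ for all $\mu$. A cost function is a lower semicontinuous $c:\mathcal{X}\times\mathcal{X}\to[0,\infty]$, with OT cost $C(\mu,\nu)=\inf\{\int c\,d\pi:\pi_1=\mu,\pi_2=\nu\}$. $D^c(\nu\|\mu)=\inf_{\eta\in\mathcal{P}(\mathcal{X})}\{D(\eta\|\mu)+C(\eta,\nu)\}$. *)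

(* Defs.v *)
From HB Require Import structures.
From mathcomp Require Import all_boot all_order all_algebra.
From mathcomp Require Import all_classical all_reals all_analysis.
Set Implicit Arguments. Unset Strict Implicit. Unset Printing Implicit Defensive.
Import Order.TTheory GRing.Theory Num.Theory.
Import numFieldNormedType.Exports.
Local Open Scope classical_set_scope.
Local Open Scope ring_scope.

(* Polish space: (pointed) complete metric space (Hausdorff, so the pseudometric
   is a metric) which is separable. *)
Definition polish (R : realType) (X : completePseudoMetricType R) : Prop :=
  hausdorff_space X /\ exists S : set X, countable S /\ dense S.

Notation borelX X := (g_sigma_algebraType (@open X)).

Definition wprob (R : realType) (X : completePseudoMetricType R) :=
  probability (borelX X) R.

HB.instance Definition _ (R : realType) (X : completePseudoMetricType R) :=
  gen_eqMixin (wprob X).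
HB.instance Definition _ (R : realType) (X : completePseudoMetricType R) :=
  gen_choiceMixin (wprob X).

Definition bounded_continuous (R : realType) (X : completePseudoMetricType R)
  (f : X -> R) : Prop := continuous f /\ exists M : R, forall x, `|f x| <= M.

(* The weak (Prokhorov) topology on P(X): generated by the subbase of sets
   { Q | a < \int f dQ < b } for f bounded continuous and a, b real,
   i.e. the coarsest topology making Q |-> \int f dQ continuous for all
   bounded continuous f. *)
Definition weak_subbase_index (R : realType) (X : completePseudoMetricType R)
  : set ((X -> R) * (R * R)) := [set i | bounded_continuous i.1].

Definition weak_subbase (R : realType) (X : completePseudoMetricType R)
  (i : (X -> R) * (R * R)) : set (wprob X) :=
  [set Q : wprob X | ((i.2.1)%:E < \int[Q]_x (i.1 x)%:E)%E /\
                     (\int[Q]_x (i.1 x)%:E < (i.2.2)%:E)%E].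

HB.instance Definition _ (R : realType) (X : completePseudoMetricType R) :=
  @isSubBaseTopological.Build (wprob X) _ (@weak_subbase_index R X)
    (@weak_subbase R X).

Definition pre_divergence (R : realType) (X : completePseudoMetricType R)
  (D : wprob X -> wprob X -> \bar R) : Prop :=
  (forall P Q, (0 <= D P Q)%E) /\ (forall P, D P P = 0%E).

Definition cost_function (R : realType) (X : completePseudoMetricType R)
  (c : X * X -> \bar R) : Prop :=
  (forall z, (0 <= c z)%E) /\ lower_semicontinuous c.

(* Couplings of mu and nu: probability measures on X x X (product sigma
   algebra = Borel sigma algebra of X x X, X being Polish) with marginals
   mu and nu. *)
Definition coupling (R : realType) (X : completePseudoMetricType R)
  (mu nu : wprob X) (pi : probability (borelX X * borelX X)%type R) : Prop :=
  (forall A : set (borelX X), measurable A -> pi (A `*` setT) = mu A) /\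
  (forall A : set (borelX X), measurable A -> pi (setT `*` A) = nu A).

Definition OTcost (R : realType) (X : completePseudoMetricType R)
  (c : X * X -> \bar R) (mu nu : wprob X) : \bar R :=
  ereal_inf [set (\int[pi]_z c z)%E
            | pi in [set pi | coupling mu nu pi]].

Definition Dc (R : realType) (X : completePseudoMetricType R)
  (D : wprob X -> wprob X -> \bar R) (c : X * X -> \bar R) (nu mu : wprob X)
  : \bar R :=
  ereal_inf [set (D eta mu + OTcost c eta nu)%E | eta in [set: wprob X]].

Definition is_mixture (R : realType) (X : completePseudoMetricType R)
  (t : R) (P1 P2 Q : wprob X) : Prop :=
  forall A : set (borelX X), measurable A ->
    Q A = ((t%:E * P1 A) + ((1 - t)%:E * P2 A))%E.

Definition same_measure (R : realType) (X : completePseudoMetricType R)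
  (P1 P2 : wprob X) : Prop :=
  forall A : set (borelX X), measurable A -> P1 A = P2 A.

Definition strictly_convex_on_finite (R : realType)
  (X : completePseudoMetricType R) (F : wprob X -> \bar R) : Prop :=
  forall (P1 P2 Q : wprob X) (t : R),
    (F P1 < +oo)%E -> (F P2 < +oo)%E -> ~ same_measure P1 P2 ->
    0 < t < 1 -> is_mixture t P1 P2 Q ->
    (F Q < t%:E * F P1 + (1 - t)%:E * F P2)%E.

(* Main.v *)
(* Pick an ultrafilter F on the pairs (eta, pi), pi a coupling of eta and nu,
   along which D eta mu + \int c dpi tends to Dc D c nu mu.  Compactness of the
   sublevel sets of D(. || mu) gives eta -> P along F.  To obtain a limit
   coupling without Prokhorov's theorem, put m U = lim_F pi(U) for U open: m is
   only finitely additive, but Halmos' construction (inf over open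
   neighbourhoods of compact sets, sup over compact subsets of open sets, then
   Caratheodory) turns it into a measure below m on open sets.  No mass is lost
   because P and nu are tight (Ulam), so it is a coupling of P and nu; being
   below m on the open sets {c > a}, it satisfies \int c <= lim_F \int c dpi.
   Uniqueness follows by evaluating the objective at the midpoint of two
   minimizers, the transport cost being convex. *)
Require Import Defs.
From HB Require Import structures.
From mathcomp Require Import all_boot all_order all_algebra.
From mathcomp Require Import all_classical all_reals all_analysis.
From mathcomp Require Import measurable_realfun ring lra.
Import Order.TTheory GRing.Theory Num.Theory.
Import numFieldNormedType.Exports.
Local Open Scope classical_set_scope.
Local Open Scope ring_scope.
Set Implicit Arguments.
Unset Strict Implicit.
Unset Printing Implicit Defensive.

(** * Infima and suprema of extended reals shifted by a finite summand *)

Section ereal_inf_sup_add.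
Context {R : realType}.
Implicit Types (A : set (\bar R)) (x y : \bar R).
Local Open Scope ereal_scope.

Lemma le_ereal_infDr A x y : y \is a fin_num ->
  (forall a, A a -> x <= a + y) -> x <= ereal_inf A + y.
Proof.
move=> yfin h; rewrite -leeBlDr//; apply: le_ereal_inf_tmp => a Aa.
by rewrite leeBlDr// h.
Qed.

Lemma ge_ereal_supDr A x y : y \is a fin_num ->
  (forall a, A a -> a + y <= x) -> ereal_sup A + y <= x.
Proof.
move=> yfin h; rewrite -leeBrDr//; apply: ge_ereal_sup => a Aa.
by rewrite leeBrDr// h.
Qed.

End ereal_inf_sup_add.

(** * Separating, splitting and covering compact sets *)

Section compact_splitting.
Context {R : realType} {T : topologicalType}.
Hypothesis hT : hausdorff_space T.
Hypothesis nT : normal_space T.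

Lemma compact_setD (K U : set T) : compact K -> open U -> compact (K `\` U).
Proof.
by move=> cK oU; rewrite setDE; apply: compact_closedI => //;
  exact: open_closedC.
Qed.

Lemma compact_separated (K L : set T) : compact K -> compact L ->
  K `&` L = set0 ->
  exists U V, [/\ open U, open V, K `<=` U, L `<=` V & U `&` V = set0].
Proof.
move=> cK cL KL0; apply: (@normal_openP R T).1 => //; exact: compact_closed.
Qed.

(** The compact sets [K \ U] and [K \ V] are disjoint, hence lie in disjoint open sets [P] and [Q];
    removing [P] from [K] leaves a part of [U], removing [Q] a part of [V], and no point is removed
    twice. *)
Lemma compact_setU_split (K U V : set T) : compact K -> open U -> open V ->
  K `<=` U `|` V ->
  exists K1 K2, [/\ compact K1, compact K2, K1 `<=` U, K2 `<=` V &
                    K = K1 `|` K2].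
Proof.
move=> cK oU oV KUV.
have [|P [Q [oP oQ KP KQ PQ0]]] :=
    compact_separated (compact_setD cK oU) (compact_setD cK oV).
  rewrite -subset0 => x [[Kx nUx] [_ nVx]].
  by case: (KUV x Kx).
exists (K `\` P), (K `\` Q); split; try exact: compact_setD.
- move=> x [Kx nPx]; apply: contrapT => nUx; apply: nPx; exact: KP.
- move=> x [Kx nQx]; apply: contrapT => nVx; apply: nQx; exact: KQ.
- rewrite -setDIr PQ0 setD0//.
Qed.

(** The partial unions increase, so every point of [K] is covered from some index on; the
    near-covering form of compactness along [\oo] makes that index uniform. *)
Lemma compact_sub_bigcup (K : set T) (U : (set T)^nat) : compact K ->
  (forall n, open (U n)) -> K `<=` \bigcup_n U n ->
  exists n, K `<=` \big[setU/set0]_(i < n) U i.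
Proof.
move=> /compact_near_coveringP cK oU KU.
have [x Kx|N _ hN] := cK nat \oo
    (fun n x => (\big[setU/set0]_(i < n) U i) x) _.
  have [n _ Unx] := KU x Kx.
  exists (U n, [set m | (n < m)%N]) => /=.
    by split; [exact: open_nbhs_nbhs|exists n.+1].
  by case=> y m /= [Uny nm]; rewrite -bigcup_mkord; exists n.
by exists N; apply: hN => /=.
Qed.

End compact_splitting.

(** * Measures from contents on open sets *)

Section regular_content.
Context {R : realType} {T : topologicalType}.
Hypothesis hT : hausdorff_space T.
Hypothesis nT : normal_space T.
Variable m : set T -> R.
Hypothesis m0 : m set0 = 0.
Hypothesis m_homo : forall U V, open U -> open V -> U `<=` V -> m U <= m V.
Hypothesis mU_le : forall U V, open U -> open V -> m (U `|` V) <= m U + m V.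
Hypothesis mU_ge : forall U V, open U -> open V -> U `&` V = set0 ->
  m U + m V <= m (U `|` V).

Local Open Scope ereal_scope.

(** The detour from open sets to compact sets and back turns finite into countable subadditivity,
    because a compact set meets an open cover through finitely many members. The price is that
    [open_content] may lie strictly below [m]: mass that escapes from all compact sets is lost. *)
Definition compact_content (K : set T) : \bar R :=
  ereal_inf [set (m V)%:E | V in [set V | open V /\ K `<=` V]].

Definition open_content (U : set T) : \bar R :=
  ereal_sup [set compact_content K | K in [set K | compact K /\ K `<=` U]].

Definition regular_outer (A : set T) : \bar R :=
  ereal_inf [set open_content U | U in [set U | open U /\ A `<=` U]].

Local Notation lam := compact_content.
Local Notation rho := open_content.
Local Notation mu := regular_outer.

Lemma content_ge0 U : open U -> (0 <= m U)%R.
Proof. by move=> oU; rewrite -m0 m_homo//; exact: open0. Qed.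

Lemma compact_content_le K V : open V -> K `<=` V -> lam K <= (m V)%:E.
Proof. by move=> oV KV; apply: ereal_inf_lbound; exists V. Qed.

Lemma compact_content_ge0 K : 0 <= lam K.
Proof.
by apply: le_ereal_inf_tmp => _ [V [oV _] <-]; rewrite lee_fin content_ge0.
Qed.

Lemma compact_content_fin K : lam K \is a fin_num.
Proof.
rewrite ge0_fin_numE ?compact_content_ge0//.
by rewrite (le_lt_trans (@compact_content_le K setT openT _)) ?ltry.
Qed.

Lemma compact_content0 : lam set0 = 0.
Proof.
apply/eqP; rewrite eq_le compact_content_ge0 andbT -[leRHS]/(0%:E) -m0.
by apply: compact_content_le => //; exact: open0.
Qed.

Lemma compact_contentU_le K L : lam (K `|` L) <= lam K + lam L.
Proof.
apply: le_ereal_infDr; first exact: compact_content_fin.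
move=> _ [V [oV KV] <-]; rewrite addeC; apply: le_ereal_infDr => //.
move=> _ [W [oW LW] <-]; rewrite -EFinD addrC.
rewrite (le_trans (@compact_content_le _ (V `|` W) _ _))//.
- exact: openU.
- exact: setUSS.
- by rewrite lee_fin mU_le.
Qed.

(** Disjoint open sets [P] and [Q] around [K] and [L] cut every open neighbourhood [V] of the union
    into the disjoint open pieces [V & P] and [V & Q], to which superadditivity of [m] applies. *)
Lemma compact_contentU_ge K L : compact K -> compact L -> K `&` L = set0 ->
  lam K + lam L <= lam (K `|` L).
Proof.
move=> cK cL KL0.
have [P [Q [oP oQ KP LQ PQ0]]] :=
  compact_separated (R := R) hT nT cK cL KL0.
apply: le_ereal_inf_tmp => _ [V [oV KLV] <-].
have oVP : open (V `&` P) by exact: openI.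
have oVQ : open (V `&` Q) by exact: openI.
apply: (@le_trans _ _ ((m (V `&` P))%:E + (m (V `&` Q))%:E)).
  apply: leeD; apply: compact_content_le => // x Hx; split.
  - by apply: KLV; left.
  - exact: KP.
  - by apply: KLV; right.
  - exact: LQ.
rewrite -EFinD lee_fin (le_trans (mU_ge oVP oVQ _))//.
  by rewrite setIACA PQ0 setI0.
by rewrite m_homo//; [exact: openU|move=> x [[]|[]]].
Qed.

Lemma open_content_le U : open U -> rho U <= (m U)%:E.
Proof.
move=> oU; apply: ge_ereal_sup => _ [K [cK KU] <-].
exact: compact_content_le.
Qed.

Lemma compact_content_le_open K U : compact K -> K `<=` U -> lam K <= rho U.
Proof. by move=> cK KU; apply: ereal_sup_ubound; exists K. Qed.

Lemma open_content_ge0 U : 0 <= rho U.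
Proof.
rewrite -compact_content0; apply: compact_content_le_open => //.
exact: compact0.
Qed.

Lemma le_open_content U V : U `<=` V -> rho U <= rho V.
Proof.
move=> UV; apply: ge_ereal_sup => _ [K [cK KU] <-].
by apply: compact_content_le_open => //; exact: subset_trans UV.
Qed.

Lemma open_content0 : rho set0 = 0.
Proof.
apply/eqP; rewrite eq_le open_content_ge0 andbT -[leRHS]/(0%:E) -m0.
by apply: open_content_le; exact: open0.
Qed.

Lemma open_contentU_le U V : open U -> open V -> rho (U `|` V) <= rho U + rho V.
Proof.
move=> oU oV; apply: ge_ereal_sup => _ [K [cK KUV] <-].
have [K1 [K2 [cK1 cK2 K1U K2V ->]]] :=
  compact_setU_split (R := R) hT nT cK oU oV KUV.
rewrite (le_trans (compact_contentU_le _ _))// leeD//;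
  exact: compact_content_le_open.
Qed.

(** Each compact subset of the union already lies in a finite partial union, where binary
    subadditivity suffices. *)
Lemma open_content_sigma_subadditive (U : (set T)^nat) :
  (forall n, open (U n)) -> rho (\bigcup_n U n) <= \sum_(n <oo) rho (U n).
Proof.
move=> oU; apply: ge_ereal_sup => _ [K [cK KU] <-].
have [n Kn] := compact_sub_bigcup cK oU KU.
rewrite (le_trans (compact_content_le_open cK Kn))//.
apply: le_trans (nneseries_lim_ge n _); last first.
  by move=> k _ _; exact: open_content_ge0.
rewrite big_mkord.
elim: n {Kn} => [|n ih]; first by rewrite !big_ord0 open_content0.
rewrite !big_ord_recr/=; apply: le_trans (leeD ih (lexx _)).
by apply: open_contentU_le => //; rewrite -bigcup_mkord; exact: bigcup_open.
Qed.

Lemma regular_outer_open U : open U -> mu U = rho U.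
Proof.
move=> oU; apply/eqP; rewrite eq_le; apply/andP; split.
  by apply: ereal_inf_lbound; exists U => //; split.
by apply: le_ereal_inf_tmp => _ [V [oV UV] <-]; exact: le_open_content.
Qed.

Lemma regular_outer_ge0 A : 0 <= mu A.
Proof. by apply: le_ereal_inf_tmp => _ [V _ <-]; exact: open_content_ge0. Qed.

Lemma le_regular_outer : {homo mu : A B / A `<=` B >-> A <= B}.
Proof.
move=> A B AB; apply: le_ereal_inf_tmp => _ [V [oV BV] <-].
by apply: ereal_inf_lbound; exists V => //; split => //; exact: subset_trans BV.
Qed.

Lemma regular_outer_le A U : open U -> A `<=` U -> mu A <= rho U.
Proof. by move=> oU AU; apply: ereal_inf_lbound; exists U. Qed.

Lemma regular_outer_fin A : mu A \is a fin_num.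
Proof.
rewrite ge0_fin_numE ?regular_outer_ge0//.
rewrite (le_lt_trans (@le_regular_outer _ setT _))//.
rewrite regular_outer_open; last exact: openT.
by rewrite (le_lt_trans (open_content_le openT)) ?ltry.
Qed.

Lemma regular_outer0 : mu set0 = 0.
Proof. by rewrite regular_outer_open ?open_content0//; exact: open0. Qed.

Lemma regular_outer_sigma_subadditive : sigma_subadditive mu.
Proof.
move=> A; apply/lee_addgt0Pr => e e0.
rewrite (le_trans _ (epsilon_trick _ _ _))//; last 2 first.
- by move=> n; exact: regular_outer_ge0.
- exact: ltW.
have /choice[U PU] n : exists U, [/\ open U, A n `<=` U &
    rho U <= mu (A n) + (e / (2 ^ n.+1)%:R)%:E].
  have en : (0 < e / (2 ^ n.+1)%:R)%R by rewrite divr_gt0// ltr0n expn_gt0.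
  have [_ [U [oU AU] <-] /ltW h] :=
    lb_ereal_inf_adherent en (regular_outer_fin (A n)).
  by exists U.
rewrite (le_trans (@regular_outer_le _ (\bigcup_n U n) _ _))//.
- by apply: bigcup_open => n _; have [] := PU n.
- by apply: subset_bigcup => n _; have [] := PU n.
rewrite (le_trans (open_content_sigma_subadditive _))//.
  by move=> n; have [] := PU n.
apply: lee_nneseries => [n _ _|n _]; first exact: open_content_ge0.
by have [] := PU n.
Qed.

HB.instance Definition _ := isOuterMeasure.Build R T mu regular_outer0
  regular_outer_ge0 le_regular_outer regular_outer_sigma_subadditive.

(** For an open [W] containing [A], the set [W & U] is exhausted by compact sets [K]. Then [W \ K]
    is an open neighbourhood of [A \ U], exhausted in turn by compact sets [L], which are disjoint
    from [K]. Superadditivity on [L] and [K] bounds the two contributions by the content of [W]. *)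
Lemma open_caratheodory U : open U -> caratheodory_measurable mu U.
Proof.
move=> oU; apply: le_caratheodory_measurable => A.
apply: le_ereal_inf_tmp => _ [W [oW AW] <-].
rewrite (le_trans (leeD (regular_outer_le (openI oW oU) _) (lexx _)))//.
  exact: setSI.
apply: ge_ereal_supDr; first exact: regular_outer_fin.
move=> _ [K [cK KWU] <-].
have oWK : open (W `\` K).
  rewrite setDE; apply: openI => //; apply: closed_openC.
  exact: compact_closed.
rewrite addeC (le_trans (leeD (regular_outer_le oWK _) (lexx _)))//.
  by move=> x [Ax nUx]; split; [exact: AW|move=> /KWU[]].
apply: ge_ereal_supDr; first exact: compact_content_fin.
move=> _ [L [cL LWK] <-].
rewrite (le_trans (compact_contentU_ge cL cK _))//.
  by rewrite -subset0 => x [/LWK[_ +] Kx].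
apply: compact_content_le_open; first exact: compactU.
by move=> x [/LWK[]//|/KWU[]].
Qed.

Lemma smallest_open_caratheodory :
  <<s @open T >> `<=` caratheodory_measurable mu.
Proof.
apply: smallest_sub; last by move=> U; exact: open_caratheodory.
split; first exact: caratheodory_measurable_set0.
- by move=> A mA; rewrite setTD; exact: caratheodory_measurable_setC.
- by move=> A mA; exact: caratheodory_measurable_bigcup.
Qed.

Lemma regular_outer_sigma_additive (A : (set T)^nat) :
  (forall n, <<s @open T >> (A n)) -> trivIset setT A ->
  (fun n => \sum_(0 <= i < n) mu (A i)) @ \oo --> mu (\bigcup_n A n).
Proof.
move=> mA tA.
have cA n : caratheodory_measurable mu (A n).
  exact: smallest_open_caratheodory.
suff -> : mu (\bigcup_n A n) = \sum_(n <oo) mu (A n).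
  by apply: is_cvg_nneseries => n _ _; exact: regular_outer_ge0.
apply/eqP; rewrite eq_le regular_outer_sigma_subadditive/=.
(* The test set is the union itself, so the remainder outside the union is empty. *)
have := caratheodory_lime_le cA tA (\bigcup_n A n).
rewrite setICr outer_measure0 adde0; apply: le_trans.
rewrite le_eqVlt; apply/orP; left; apply/eqP; apply: eq_eseriesr => n _.
by rewrite setIC; congr (mu _); apply/esym/setIidPl; exact: bigcup_sup.
Qed.

End regular_content.

(** * Polish spaces *)

Lemma hausdorff_prod (S T : topologicalType) :
  hausdorff_space S -> hausdorff_space T -> hausdorff_space (S * T)%type.
Proof.
move=> hS hT [p1 p2] [q1 q2] pq; congr pair.
- apply: hS => A B pA qB.
  have [||[x y] [/= [Ax _] [Bx _]]] := pq (A `*` setT) (B `*` setT).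
  + by exists (A, setT) => //; split => //; exact: filterT.
  + by exists (B, setT) => //; split => //; exact: filterT.
  + by exists x.
- apply: hT => A B pA qB.
  have [||[x y] [/= [_ Ay] [_ By]]] := pq (setT `*` A) (setT `*` B).
  + by exists (setT, A) => //; split => //; exact: filterT.
  + by exists (setT, B) => //; split => //; exact: filterT.
  + by exists y.
Qed.

Lemma ultra_bigsetU (I : Type) (F : set_system I) (A : (set I)^nat) n :
  UltraFilter F -> F (\big[setU/set0]_(i < n) A i) -> exists i, F (A i).
Proof.
move=> FU; elim: n => [|n ih]; first by rewrite big_ord0 => /filter_ex[].
rewrite big_ord_recr/= => FAn.
have [|FC] := in_ultra_setVsetC (A n) FU; first by exists n.
apply: ih; apply: filterS (filterI FAn FC) => x [[//|Anx] nAnx].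
by [].
Qed.

Section polish_space.
Context {R : realType} {X : completePseudoMetricType R}.

Lemma polish_dense_seq (x0 : X) : polish X ->
  exists s : nat -> X, forall x e, 0 < e -> exists n, ball x e (s n).
Proof.
move=> [_ [S [/countable_injP[f fI] dS]]].
(* The sequence inverts the injection [f] from [S] to the naturals; [x0] fills the indices that [f]
   does not reach on [S]. *)
exists (fun n => xget x0 [set x | S x /\ f x = n]) => x e e0.
have [|s [/interior_subset xs Ss]] := dS (ball x e)° _ (open_interior _).
  by exists x; apply: nbhsx_ballx.
exists (f s); case: xgetP => [y _ [Sy fy]|/(_ s)]; last by case.
by rewrite (fI _ _ _ _ fy)// inE.
Qed.

(* Balls of a pseudometric space need not be open here, hence the interior. *)
Definition rational_ball (s : nat -> X) (nk : nat * nat) : set X :=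
  (ball (s nk.1) nk.2.+1%:R^-1)°.

Lemma rational_ball_base (s : nat -> X) (x : X) (A : set X) :
  (forall x e, 0 < e -> exists n, ball x e (s n)) -> nbhs x A ->
  exists nk, rational_ball s nk x /\ rational_ball s nk `<=` A.
Proof.
move=> sP /nbhs_ballP[e /= e0 eA].
have e20 : 0 < e / 2 by rewrite divr_gt0.
have [k _ /(_ _ (leqnn k)) ke] := near_infty_natSinv_lt (PosNum e20).
(* Taking [s n] within half the radius of [x] leaves room for a ball around [x], which puts [x] in
   the interior of the ball around [s n]. *)
have r0 : 0 < k.+1%:R^-1 / 2 :> R by rewrite divr_gt0.
have [n xsn] := sP x _ r0.
exists (n, k); split => /=.
  apply/nbhs_ballP; exists (k.+1%:R^-1 / 2) => //= y xy.
  exact: ball_split (ball_sym xsn) xy.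
move=> y /interior_subset /= sy; apply: eA; apply: ball_split (le_ball _ xsn) _.
  by rewrite (le_trans _ (ltW ke))//= ler_pdivrMr// ler_peMr// ler1n.
by apply: le_ball sy; exact: ltW.
Qed.

(** Separability enters here: the countably many products of rational balls form a base of the
    product topology, so an open set is a countable union of measurable rectangles. *)
Lemma open_measurable_prod (U : set (X * X)) : polish X -> open U ->
  measurable (U : set (borelX X * borelX X)).
Proof.
move=> pX oU.
have [U0|/set0P[[x0 _] _]] := eqVneq U set0.
  by rewrite U0; exact: measurable0.
have [s sP] := polish_dense_seq x0 pX.
pose V (i : (nat * nat) * (nat * nat)) : set (X * X) :=
  rational_ball s i.1 `*` rational_ball s i.2.
(* Rectangles not contained in [U] are replaced by the empty set, so that the union runs over the
   whole countable index type. *)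
have -> : U = \bigcup_i (if `[< V i `<=` U >] then V i else set0).
  apply/seteqP; split => [[x y] Uxy|z [i _]]; last first.
    by case: asboolP => // + ?; apply.
  have : nbhs (x, y) U by exact: open_nbhs_nbhs.
  case=> -[A B] /= [xA yB] ABU.
  have [i [ix iA]] := rational_ball_base sP xA.
  have [j [jy jB]] := rational_ball_base sP yB.
  exists (i, j) => //; case: asboolP => [_|]; first by split.
  by case=> -[a b] [/= /iA ? /jB ?]; apply: ABU.
apply: countable_bigcupT_measurable => [|i]; first exact: countableP.
case: asboolP => [_|_]; last exact: measurable0.
by apply: measurableX; apply: sub_sigma_algebra; exact: open_interior.
Qed.

Lemma closed_borel (A : set X) : closed A -> measurable (A : set (borelX X)).
Proof.
move=> cA; rewrite -(setCK A); apply: measurableC.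
by apply: sub_sigma_algebra; exact: closed_openC.
Qed.

(** Ulam's tightness theorem. For every [k], finitely many closures of rational balls of radius
    [1/(k+1)] carry all mass but [e/2^(k+1)]. The intersection over [k] is closed and totally
    bounded, hence compact by completeness. *)
Lemma ulam (P : wprob X) (e : R) : polish X -> 0 < e ->
  exists2 K : set X, compact K & (P (~` (K : set (borelX X))) <= e%:E)%E.
Proof.
move=> pX e0.
have [x0 _] : [set: X] !=set0.
  apply/set0P/eqP => X0; have := @probability_setT _ _ _ P.
  by rewrite [[set: _]]X0 measure0 => /eqP; rewrite eqe eq_sym oner_eq0.
have [s sP] := polish_dense_seq x0 pX.
pose G k N : set (borelX X) :=
  \big[setU/set0]_(i < N) closure (rational_ball s (nat_of_ord i, k)).
have cG k N : closed (G k N : set X).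
  by apply: closed_bigsetU => i _; exact: closed_closure.
have mG k N : measurable (G k N) by apply: closed_borel; exact: cG.
have /choice[N PN] k : exists N, (P (~` G k N) <= (e / (2 ^ k.+1)%:R)%:E)%E.
  have ek : 0 < e / (2 ^ k.+1)%:R by rewrite divr_gt0// ltr0n expn_gt0.
  (* The complements decrease, and by density of [s] their intersection is empty, so their measures
     tend to 0. *)
  have : P \o (fun N => ~` G k N) @ \oo --> P (\bigcap_N ~` G k N).
    apply: nonincreasing_cvg_mu.
    - by rewrite (le_lt_trans (probability_le1 _ _)) ?ltry//; exact: measurableC.
    - by move=> N; exact: measurableC.
    - by apply: bigcapT_measurable => N; exact: measurableC.
    - move=> m n mn; apply/subsetPset; apply: subsetC; rewrite /G.
      by rewrite -!(bigcup_mkord _ (fun i => closure (rational_ball s (i, k))));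
        apply: bigcup_subset => i /= /leq_trans; exact.
  rewrite (_ : \bigcap_N _ = set0) ?measure0; last first.
    rewrite -subset0 => x /= h.
    have r0 : 0 < k.+1%:R^-1 / 2 :> R by rewrite divr_gt0.
    have [n xsn] := sP x _ r0.
    apply: (h n.+1) => //; rewrite /G.
    rewrite -(bigcup_mkord _ (fun i => closure (rational_ball s (i, k)))).
    exists n => //=; apply: subset_closure; apply/nbhs_ballP.
    exists (k.+1%:R^-1 / 2) => //= y xy.
    exact: ball_split (ball_sym xsn) xy.
  move=> /(_ [set x | (x < (e / (2 ^ k.+1)%:R)%:E)%E]) [|N _ /(_ N (leqnn N))].
    apply: open_nbhs_nbhs; split; first exact: open_ereal_lt_ereal.
    by rewrite /= lte_fin.
  by move=> /ltW; exists N.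
exists (\bigcap_k G k (N k)).
  rewrite compact_ultra => F FU FK.
  have clK : closed (\bigcap_k G k (N k) : set X) by exact: closed_bigI.
  (* For every [k] the ultrafilter selects one of the finitely many small closed sets, hence it is
     Cauchy. *)
  have /cauchy_cvg/cvg_ex[x Fx] : cauchy F.
    apply: cauchy_exP => d d0.
    have d20 : 0 < d / 2 by rewrite divr_gt0.
    have [k _ /(_ _ (leqnn k)) kd] := near_infty_natSinv_lt (PosNum d20).
    have : F (G k (N k)) by apply: filterS FK => y; exact.
    move=> /(@ultra_bigsetU _ _ (fun i => closure (rational_ball s (i, k))))[i Fi].
    exists (s i); apply: filterS Fi => y clBy.
    have [z [/interior_subset /= sz yz]] := clBy _ (nbhsx_ballx y _ d20).
    by apply: ball_splitl yz; apply: le_ball sz; exact: ltW.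
  exists x; split => //.
  apply: clK => B xB; exact: filter_ex (filterI FK (Fx _ xB)).
rewrite setC_bigcap (le_trans (generalized_Boole_inequality _ _ _))//.
- by move=> k; exact: measurableC.
- by apply: bigcupT_measurable => k; exact: measurableC.
apply: le_trans (epsilon_trick0 xpredT (ltW e0)).
by apply: lee_nneseries => k *; [exact: measure_ge0|exact: PN].
Qed.

(** A closed set is a decreasing intersection of open neighbourhoods, so the inequality passes from
    open to closed sets by continuity of [Q] from above. Complementation reverses it, since both
    masses are 1, and the open sets form a generating pi-system. *)
Lemma same_measure_open (P Q : wprob X) :
  (forall U : set X, open U -> (P (U : set (borelX X)) <= Q U)%E) ->
  same_measure P Q.
Proof.
move=> PQ A mA.
have mo (U : set X) : open U -> measurable (U : set (borelX X)).
  by move=> oU; exact: sub_sigma_algebra.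
apply: (@g_sigma_algebra_measure_unique _ R (borelX X) open mo (fun=> setT)
  (fun=> openT) _ P Q) => //.
- by rewrite bigcup_const//; exists 0%N.
- by move=> U V; exact: openI.
- move=> U oU; apply/eqP; rewrite eq_le PQ//=.
  have mU := mo _ oU.
  suff : (P (~` (U : set (borelX X))) <= Q (~` (U : set (borelX X))))%E.
    by rewrite !probability_setC// leeD2lE// leeN2.
  (* Open neighbourhoods of the closed set [~ U] of radius [1/(k+1)]. *)
  pose W k : set (borelX X) := \bigcup_(x in ~` U) (ball x k.+1%:R^-1)°.
  have oW k : open (W k : set X).
    by apply: bigcup_open => x _; exact: open_interior.
  have -> : ~` U = \bigcap_k W k.
    apply/seteqP; split => [x nUx k _|x Wx].
      by exists x => //; apply: nbhsx_ballx; rewrite invr_gt0.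
    have /closure_id -> : closed (~` U) by exact: open_closedC.
    move=> B /nbhs_ballP[e /= e0 eB].
    have [k _ /(_ _ (leqnn k)) ke] := near_infty_natSinv_lt (PosNum e0).
    have [y nUy /interior_subset yx] := Wx k I.
    exists y; split => //; apply: eB; apply: ball_sym.
    by apply: le_ball yx; exact: ltW.
  have mW : measurable (\bigcap_k W k).
    by apply: bigcapT_measurable => k; exact: mo.
  have cv : Q \o W @ \oo --> Q (\bigcap_k W k).
    apply: nonincreasing_cvg_mu => //.
    - by rewrite (le_lt_trans (probability_le1 _ _)) ?ltry//; exact: mo.
    - by move=> k; exact: mo.
    - move=> m n mn; apply/subsetPset; apply: subset_bigcup => x _.
      by apply: interiorS; apply: le_ball; rewrite lef_pV2 ?posrE// ler_nat.
  rewrite -(cvg_lim _ cv)//; apply: lime_ge.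
    by apply/cvg_ex; exists (Q (\bigcap_k W k)).
  near=> k; apply: le_trans (PQ _ (oW k)).
  by apply: le_measure; rewrite ?inE//; [exact: mo|exact: bigcap_inf].
- by move=> _; rewrite (le_lt_trans (probability_le1 _ _)) ?ltry.
Unshelve. all: by end_near.
Qed.

End polish_space.

(** * Measurability from superlevel sets, and probabilities from set functions *)

Lemma measurable_fun_superlevel d (T : measurableType d) (R : realType)
    (f : T -> \bar R) :
  (forall a : R, measurable [set x | (a%:E < f x)%E]) -> measurable_fun setT f.
Proof.
move=> mf; apply: (measurability _ (ErealGenOInfty.measurableE R)).
move=> /= _ [_ [a ->]] <-; rewrite setTI preimage_itvoy.
exact: mf.
Qed.

Lemma exists_probability d (T : measurableType d) (R : realType)
    (f : set T -> \bar R) :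
  f set0 = 0%E -> (forall A, 0 <= f A)%E -> semi_sigma_additive f ->
  f setT = 1%E -> exists P : probability T R, forall A, P A = f A.
Proof.
move=> f0 f_ge0 fD f1.
pose m : {measure set T -> \bar R} :=
  HB.pack f (isMeasure.Build d T R f f0 f_ge0 fD).
pose P : probability T R :=
  HB.pack f (Measure.on m) (Measure_isProbability.Build d T R m f1).
by exists P.
Qed.

(** * Limits along ultrafilters *)

Section ultrafilter_limits.
Context {R : realType}.

Lemma ultra_fmap (I J : Type) (f : I -> J) (F : set_system I) :
  UltraFilter F -> UltraFilter (f @ F).
Proof.
move=> FU; split; first exact: fmap_proper_filter.
move=> G GF FG; apply/seteqP; split => // A GA.
have [//|FnA] := in_ultra_setVsetC (f @^-1` A) FU.
have /filter_ex[x []//] : G (A `&` ~` A).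
by apply: filterI => //; apply: FG.
Qed.

Lemma ultra_bounded_cvg (I : Type) (F : set_system I) (f : I -> R) (a b : R) :
  UltraFilter F -> (forall i, a <= f i <= b) -> cvg (f @ F).
Proof.
move=> FU fab; have := @segment_compact R a b; rewrite compact_ultra.
case/(_ (f @ F)) => [||l [_ fl]]; last by apply/cvg_ex; exists l.
  exact: ultra_fmap.
by apply: (@filterE _ F) => i; rewrite /= in_itv; exact: fab.
Qed.

Lemma le_cvg_near (I : Type) (F : set_system I) (f g : I -> R) (l k : R) :
  ProperFilter F -> f @ F --> l -> g @ F --> k ->
  (\forall i \near F, f i <= g i) -> l <= k.
Proof.
move=> FF fl gk fg; rewrite -subr_ge0.
apply: (@cvgr_to_ge _ F _ _ (g \- f)); first exact: cvgB.
by apply: filterS fg => i; rewrite subr_ge0.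
Qed.

End ultrafilter_limits.

(** * Weak convergence and a portmanteau inequality *)

Section weak_convergence.
Context {R : realType} {X : completePseudoMetricType R}.

Lemma weak_subbase_open (i : (X -> R) * (R * R)) :
  bounded_continuous i.1 -> open (weak_subbase i).
Proof.
move=> ci; exists [set weak_subbase i]; last by rewrite bigcup_set1.
by move=> _ ->; exact: finI_from1.
Qed.

(* A Urysohn function between A and U gives the bound without assuming that the
   boundary of A is P-null. *)
Lemma portmanteau (I : Type) (F : set_system I) (eta : I -> wprob X)
    (P : wprob X) (A U : set X) (e : R) {FF : Filter F} : eta @ F --> P ->
  closed A -> open U -> A `<=` U -> 0 < e ->
  \forall i \near F,
    (eta i (A : set (borelX X)) <= P (U : set (borelX X)) + e%:E)%E.
Proof.
move=> etaP cA oU AU e0.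
have mo (V : set X) : open V -> measurable (V : set (borelX X)).
  by move=> oV; exact: sub_sigma_algebra.
have mA : measurable (A : set (borelX X)) by exact: closed_borel.
have [|g [cg g01 gU gA]] := (@uniform_separatorP _ R (~` U) A).1.
  apply: (@normal_separatorP R X).1; [exact: pseudometric_normal| |by []|].
    exact: open_closedC.
  by rewrite -subset0 => x [nUx /AU].
have g_ge0 x : 0 <= g x by have /andP[] : g x \in `[0, 1] by apply: g01; exists x.
have g_le1 x : g x <= 1 by have /andP[] : g x \in `[0, 1] by apply: g01; exists x.
have mg : measurable_fun [set: borelX X] (EFin \o g).
  apply: measurable_fun_superlevel => a; apply: mo.
  rewrite [X in open X](_ : _ = g @^-1` [set x | a < x]); last first.
    by apply/seteqP; split => x; rewrite /= lte_fin.
  by apply: open_comp => [x _|]; [exact: cg|exact: open_gt].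
have PgU : (\int[P]_x (g x)%:E <= P (U : set (borelX X)))%E.
  rewrite -(setIT U) -integral_indic//; last exact: mo.
  apply: ge0_le_integral => //.
  - by move=> x _; rewrite lee_fin.
  - by apply/measurable_EFinP/measurable_indic; exact: mo.
  - move=> x _; rewrite lee_fin indicE; have [xU|xU] := boolP (x \in U) => //.
    by rewrite (imsub1 gU)//= => /mem_set; exact/negP.
have fin : P (U : set (borelX X)) \is a fin_num.
  by apply: fin_num_measure; exact: mo.
(* The upper bound [P U + e] carries the estimate; the lower bound -1 holds automatically because
   [g] is nonnegative. *)
have oW : open (weak_subbase (g, (-1, fine (P (U : set (borelX X))) + e))).
  apply: weak_subbase_open; split => //; exists 1 => x.
  by rewrite ger0_norm.
have : nbhs P (weak_subbase (g, (-1, fine (P (U : set (borelX X))) + e))).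
  apply: open_nbhs_nbhs; split => //; split => /=.
    apply: (@lt_le_trans _ _ 0%E); first by rewrite lte_fin ltrN10.
    by apply: integral_ge0 => x _; rewrite lee_fin.
  by rewrite (le_lt_trans PgU)// EFinD fineK// lteDl// lte_fin.
move=> /etaP; apply: (@filterS _ F) => i [_ /= /ltW gi].
rewrite -[X in (_ <= X + _)%E]fineK// -EFinD; apply: le_trans gi.
rewrite -(setIT A) -integral_indic//; apply: ge0_le_integral => //.
- by apply/measurable_EFinP/measurable_indic.
- move=> x _; rewrite lee_fin indicE; have [xA|//] := boolP (x \in A).
  by rewrite (imsub1 gA)//=; exact: set_mem.
Qed.

End weak_convergence.

Lemma exists_pushforward d d' (T1 : measurableType d) (T2 : measurableType d')
    (R : realType) (P : probability T1 R) (f : T1 -> T2) :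
  measurable_fun setT f ->
  exists Q : probability T2 R, forall A, Q A = P (f @^-1` A).
Proof.
move=> mf.
pose g : {mfun T1 >-> T2} := HB.pack f (isMeasurableFun.Build d d' T1 T2 f mf).
by exists (distribution P g).
Qed.

Lemma open_setX (S T : topologicalType) (A : set S) (B : set T) :
  open A -> open B -> open (A `*` B).
Proof.
move=> oA oB.
have -> : A `*` B = (fst @^-1` A) `&` (snd @^-1` B) by [].
apply: openI; apply: open_comp => // -[x y] _; first exact: cvg_fst.
exact: cvg_snd.
Qed.

(** * Limits of couplings along an ultrafilter *)

Section limit_coupling.
Context {R : realType} {X : completePseudoMetricType R}.

(** The map [f] is the identity, read from the Borel sigma-algebra of the product space to the
    product sigma-algebra; it is measurable because both projections are continuous. *)
Lemma prod_borel_sub (A : set (borelX X * borelX X)) :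
  measurable A -> <<s @open (X * X)%type >> A.
Proof.
move=> mA.
pose f (x : borelX (X * X)%type) : borelX X * borelX X := (fst x, snd x).
have mf : measurable_fun setT f.
  apply: measurable_fun_pair; apply: (@measurability _ _
    (borelX (X * X)%type) (borelX X) _ _ (@open X)) => //.
    move=> _ [U oU <-]; rewrite setTI; apply: sub_sigma_algebra.
    by apply: open_comp => // x _; exact: cvg_fst.
  move=> _ [U oU <-]; rewrite setTI; apply: sub_sigma_algebra.
  by apply: open_comp => // x _; exact: cvg_snd.
have := mf measurableT A mA; rewrite setTI.
by congr (<<s _ >> _); apply/seteqP; split => -[].
Qed.

Lemma compact_lebesgue_number (T : pseudoMetricType R) (K V : set T) :
  compact K -> open V -> K `<=` V ->
  exists2 e : R, 0 < e & forall x, K x -> ball x e `<=` V.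
Proof.
move=> /compact_near_coveringP cK oV KV.
have [x Kx|n _ hn] := cK nat \oo (fun n x => ball x n.+1%:R^-1 `<=` V) _.
  have /nbhs_ballP[e /= e0 eV] : nbhs x V.
    exact: open_nbhs_nbhs (conj oV (KV x Kx)).
  have e20 : 0 < e / 2 by rewrite divr_gt0.
  exists (ball x (e / 2), [set n | n.+1%:R^-1 < e / 2]) => /=.
    by split; [exact: nbhsx_ballx|exact: (near_infty_natSinv_lt (PosNum e20))].
  case=> y n /= [xy ne] z yz; apply: eV; apply: ball_split xy _.
  by apply: le_ball yz; exact: ltW.
by exists n.+1%:R^-1 => // x Kx; apply: hn => /=.
Qed.

(** Balls of the product are products of balls, so a Lebesgue number of [K * L] in [V] serves as the
    thickening radius for both factors. *)
Lemma tube (K L : set X) (V : set (X * X)) : compact K -> compact L ->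
  open V -> K `*` L `<=` V ->
  exists A B, [/\ open A, open B, K `<=` A, L `<=` B & A `*` B `<=` V].
Proof.
move=> cK cL oV KLV.
have [e e0 eV] := compact_lebesgue_number (compact_setX cK cL) oV KLV.
exists (\bigcup_(x in K) (ball x e)°), (\bigcup_(y in L) (ball y e)°); split.
- by apply: bigcup_open => x _; exact: open_interior.
- by apply: bigcup_open => x _; exact: open_interior.
- by move=> x Kx; exists x => //; exact: nbhsx_ballx.
- by move=> x Lx; exists x => //; exact: nbhsx_ballx.
- move=> [a b] [/= [x Kx /interior_subset xa] [y Ly /interior_subset yb]].
  exact: (eV (x, y)).
Qed.

(** The candidate is [regular_outer m], with [m] the ultralimit of the couplings on open sets. Total
    mass 1 comes from tightness. Once it is known, each marginal needs only a one-sided comparison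
    on open sets, by [same_measure_open]. *)
Lemma limit_coupling (I : Type) (F : set_system I) (eta : I -> wprob X)
    (pi_ : I -> probability (borelX X * borelX X)%type R) (P nu : wprob X) :
  UltraFilter F -> polish X -> (forall i, coupling (eta i) nu (pi_ i)) ->
  eta @ F --> P ->
  exists2 pi : probability (borelX X * borelX X)%type R, coupling P nu pi &
    forall U : set (X * X), open U ->
      (pi (U : set (borelX X * borelX X)) <=
       (lim (fine (pi_ i (U : set (borelX X * borelX X))) @[i --> F]))%:E)%E.
Proof.
move=> FU pX cpl etaP.
have FF : Filter F by exact: filter_filter.
have hX : hausdorff_space (X * X)%type by apply: hausdorff_prod; case: pX.
have nX : normal_space (X * X)%type by exact: pseudometric_normal.
have mo U := @open_measurable_prod _ _ U pX.
have mX (V : set X) : open V -> measurable (V : set (borelX X)).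
  by move=> oV; exact: sub_sigma_algebra.
pose f (U : set (borelX X * borelX X)) i := fine (pi_ i U).
have f01 (U : set (X * X)) i : open U -> 0 <= f U i <= 1.
  move=> oU; rewrite fine_ge0//= -lee_fin fineK ?fin_num_measure//; [|exact: mo..].
  by apply: probability_le1; exact: mo.
have fE (U : set (X * X)) i : open U -> pi_ i U = (f U i)%:E.
  by move=> oU; rewrite fineK// fin_num_measure//; exact: mo.
pose m U := lim (f U @ F).
have cvm (U : set (X * X)) : open U -> f U @ F --> m U.
  by move=> oU; apply: ultra_bounded_cvg => i; exact: f01.
have m0 : m set0 = 0.
  rewrite /m (_ : f set0 = cst 0) ?lim_cst//.
  by apply/funext => i; rewrite /f measure0.
have m_homo (U V : set (X * X)) : open U -> open V -> U `<=` V -> m U <= m V.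
  move=> oU oV UV; apply: le_cvg_near (cvm _ oU) (cvm _ oV) _.
  apply: filterE => i; rewrite -lee_fin -!fE//.
  by apply: le_measure; rewrite ?inE//; exact: mo.
have mU_le (U V : set (X * X)) : open U -> open V -> m (U `|` V) <= m U + m V.
  move=> oU oV.
  apply: le_cvg_near (cvm _ (openU oU oV)) (cvgD (cvm _ oU) (cvm _ oV)) _.
  apply: filterE => i; rewrite -lee_fin EFinD -!fE//; last exact: openU.
  by apply: measureU2; exact: mo.
have mU_ge (U V : set (X * X)) : open U -> open V -> U `&` V = set0 ->
    m U + m V <= m (U `|` V).
  move=> oU oV UV0.
  apply: le_cvg_near (cvgD (cvm _ oU) (cvm _ oV)) (cvm _ (openU oU oV)) _.
  apply: filterE => i; rewrite -lee_fin EFinD -!fE//; last exact: openU.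
  by rewrite measureU//; exact: mo.
pose mu := regular_outer m.
have muo U : open U -> mu U = open_content m U.
  by move=> oU; apply: regular_outer_open.
have mu_le U : open U -> (mu U <= (m U)%:E)%E.
  by move=> oU; rewrite muo//; exact: open_content_le.
have muD : semi_sigma_additive (mu : set (borelX X * borelX X) -> \bar R).
  move=> A mA tA _; apply: (regular_outer_sigma_additive hX nX) => // n.
  exact: prod_borel_sub.
have cfst U i : open U -> pi_ i (U `*` setT) = eta i U.
  by move=> oU; rewrite (cpl i).1//; exact: mX.
have csnd U i : open U -> pi_ i (setT `*` U) = nu U.
  by move=> oU; rewrite (cpl i).2//; exact: mX.
have oXT (U : set X) : open U -> open (U `*` setT : set (X * X)).
  by move=> oU; apply: open_setX => //; exact: openT.
have oTX (U : set X) : open U -> open (setT `*` U : set (X * X)).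
  by move=> oU; apply: open_setX => //; exact: openT.
have mass1 : mu setT = 1%E.
  apply/eqP; rewrite eq_le; apply/andP; split.
    apply: le_trans (mu_le _ openT) _; rewrite lee_fin; apply: limr_le.
      by apply: ultra_bounded_cvg => i; exact: f01 openT.
    by apply: filterE => i; have /andP[] := f01 setT i openT.
  apply/lee_addgt0Pr => e e0.
  (* The three thirds pay for the mass of [P] outside [K], the error in the portmanteau inequality,
     and the mass of [nu] outside [L]. *)
  have e30 : 0 < e / 3 by rewrite divr_gt0.
  have [K cK PK] := ulam P pX e30.
  have [L cL nuL] := ulam nu pX e30.
  have hX1 : hausdorff_space X by case: pX.
  have KLmu : (compact_content m (K `*` L) <= mu setT)%E.
    rewrite muo; last exact: openT.
    by apply: compact_content_le_open => //; exact: compact_setX.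
  rewrite -leeBlDr//; apply: le_trans KLmu.
  apply: le_ereal_inf_tmp => _ [V [oV KLV] <-].
  (* Inside [V] the rectangle [A * B] can be measured through marginals: its complement has mass at
     most [eta i (~ A) + nu (~ B)]. *)
  have [A [B [oA oB KA LB ABV]]] := tube cK cL oV KLV.
  rewrite -EFinB lee_fin; apply: limr_ge.
    by apply: ultra_bounded_cvg => i; exact: f01 oV.
  have := portmanteau (FF := FF) etaP (open_closedC oA)
    (closed_openC (compact_closed hX1 cK)) (subsetC KA) e30.
  apply: (@filterS _ F) => i etaA.
  rewrite -lee_fin -fE//.
  have mAB : measurable (~` ((A : set (borelX X)) `*` (B : set (borelX X)))).
    by apply: measurableC; apply: measurableX; exact: mX.
  have mAc : measurable (~` (A : set (borelX X))) by apply: measurableC; exact: mX.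
  have mBc : measurable (~` (B : set (borelX X))) by apply: measurableC; exact: mX.
  apply: (@le_trans _ _
    (pi_ i ((A : set (borelX X)) `*` (B : set (borelX X))))); last first.
    apply: le_measure; rewrite ?inE//; [exact: mo (open_setX oA oB)|exact: mo].
  suff h : (pi_ i (~` ((A : set (borelX X)) `*` (B : set (borelX X)))) <= e%:E)%E.
    rewrite EFinB leeBlDr// -leeBlDl; last first.
      by apply: fin_num_measure; exact: mo (open_setX oA oB).
    by rewrite -probability_setC//; exact: mo (open_setX oA oB).
  have : ~` ((A : set (borelX X)) `*` (B : set (borelX X))) `<=`
         ((~` A) `*` setT) `|` (setT `*` (~` B)).
    move=> [x y] /= nAB; have [Ax|nAx] := pselect (A x); last by left.
    by right; split => // By; apply: nAB.
  move=> /(le_measure (pi_ i)) => /(_ _ _)/le_trans; apply.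
  - by rewrite inE.
  - by rewrite inE; apply: measurableU; apply: measurableX.
  apply: le_trans (measureU2 _ _ _) _; [exact: measurableX..|].
  rewrite [X in (X + _ <= _)%E]((cpl i).1 _ mAc).
  rewrite [X in (_ + X <= _)%E]((cpl i).2 _ mBc).
  rewrite (_ : e = e / 3 + e / 3 + e / 3); last by field.
  rewrite !EFinD; apply: leeD.
    by apply: le_trans etaA _; rewrite leeD2r.
  apply: le_trans nuL; apply: le_measure; rewrite ?inE//.
    by apply: measurableC; apply: closed_borel; exact: compact_closed.
  exact: subsetC.
have [pi piE] := @exists_probability _ (borelX X * borelX X)%type R mu
  (regular_outer0 m0 m_homo) (regular_outer_ge0 m0 m_homo) muD mass1.
have [pi1 pi1E] := exists_pushforward pi measurable_fst.
have [pi2 pi2E] := exists_pushforward pi measurable_snd.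
exists pi; last by move=> U oU; rewrite piE; exact: mu_le.
split=> A mA.
- have -> : pi (A `*` setT) = pi1 A.
    by rewrite pi1E; congr (pi _); apply/seteqP; split => -[x y] //= [].
  apply: (same_measure_open _ mA) => U oU.
  have -> : pi1 U = pi (U `*` setT).
    by rewrite pi1E; congr (pi _); apply/seteqP; split => -[x y] //= [].
  rewrite piE muo; last exact: oXT.
  apply: ge_ereal_sup => _ [K [cK KU] <-].
  have hX1 : hausdorff_space X by case: pX.
  (* The projection of [K] is separated from [~ U] by disjoint open [V] and [W]. The closed set
     [~ W] then lies between [V] and [U], as the portmanteau inequality requires. *)
  have cK1 : compact (fst @` K).
    apply: continuous_compact cK; apply: continuous_subspaceT => -[x y].
    exact: cvg_fst.
  have [|V [W [oV oW KV UW VW0]]] := (@normal_openP R X).1 pseudometric_normal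
      (fst @` K) (~` U) (compact_closed hX1 cK1) (open_closedC oU).
    by rewrite -subset0 => _ [[[x y] /KU[Ux _] <-]].
  have KVT : K `<=` V `*` setT.
    by move=> [x y] Kxy; split => //; apply: KV; exists (x, y).
  apply/lee_addgt0Pr => e e0.
  apply: le_trans (compact_content_le m (oXT _ oV) KVT) _.
  rewrite -[P U]fineK; last by apply: fin_num_measure; exact: mX.
  rewrite -EFinD lee_fin; apply: limr_le.
    by apply: ultra_bounded_cvg => i; apply: f01; exact: oXT.
  have VWU : ~` W `<=` U by move=> x nWx; apply: contrapT => /UW.
  have := portmanteau (FF := FF) etaP (open_closedC oW) oU VWU e0.
  apply: (@filterS _ F) => i etaW.
  rewrite -lee_fin -fE; last exact: oXT.
  rewrite cfst// EFinD fineK; last by apply: fin_num_measure; exact: mX.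
  apply: le_trans etaW; apply: le_measure; rewrite ?inE//.
  + exact: mX.
  + by apply: measurableC; exact: mX.
  + by move=> x Vx Wx; have : (V `&` W) x by []; rewrite VW0.
- have -> : pi (setT `*` A) = pi2 A.
    by rewrite pi2E; congr (pi _); apply/seteqP; split => -[x y] //= [].
  apply: (same_measure_open _ mA) => U oU.
  have -> : pi2 U = pi (setT `*` U).
    by rewrite pi2E; congr (pi _); apply/seteqP; split => -[x y] //= [].
  (* The second marginal is [nu] for every index, so the bound by [m] is enough and no compact
     approximation is made. *)
  rewrite piE; apply: le_trans (mu_le _ (oTX _ oU)) _.
  rewrite -[nu U]fineK; last by apply: fin_num_measure; exact: mX.
  rewrite lee_fin; apply: limr_le.
    by apply: ultra_bounded_cvg => i; apply: f01; exact: oTX.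
  by apply: filterE => i; rewrite /f csnd.
Qed.

End limit_coupling.

(** * Lower semicontinuity of the integral *)

Section staircase.
Context d (T : measurableType d) (R : realType).
Variables (c : T -> \bar R) (delta : R).
Hypothesis c_ge0 : forall x, (0 <= c x)%E.
Hypothesis delta_gt0 : 0 < delta.
Hypothesis mc : forall a : R, measurable [set x | (a%:E < c x)%E].

Let level k := [set x | ((k.+1%:R * delta)%:E < c x)%E].

(* Built from superlevel sets of c only, since those are the sets on which the
   limit coupling is controlled. *)
Definition staircase (n : nat) (x : T) : R :=
  \sum_(k < n) delta * \1_(level k) x.

Lemma staircase_ge0 n x : 0 <= staircase n x.
Proof. by apply: sumr_ge0 => k _; rewrite mulr_ge0// ltW. Qed.

Lemma staircase_le n x : ((staircase n x)%:E <= c x)%E.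
Proof.
(* The bound by [n * delta] strengthens the induction: when the top level is reached, the sum is at
   most [(n+1) * delta], which is below [c x]. *)
suff : staircase n x <= n%:R * delta /\ ((staircase n x)%:E <= c x)%E by case.
rewrite /staircase; elim: n => [|n [ih1 ih2]].
  by rewrite big_ord0 mul0r; split.
rewrite big_ord_recr/= indicE; have [xn|xn] := boolP (x \in level n).
- have h : \sum_(k < n) delta * \1_(level k) x + delta * true%:R <=
    n.+1%:R * delta by rewrite mulr1 -natr1 mulrDl mul1r lerD2r.
  split => //; apply: ltW; apply: le_lt_trans (set_mem xn).
  by rewrite lee_fin.
- rewrite mulr0 addr0; split => //; apply: le_trans ih1 _.
  by rewrite ler_pM2r// ler_nat.
Qed.

(** Rounding down to a multiple of [delta] costs at most [delta], as long as [y] is within the range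
    of the [n] steps. In the inductive step with [y] above [n * delta], the first [n] levels are all
    attained. *)
Lemma le_staircase n x y : y <= n%:R * delta -> (y%:E <= c x)%E ->
  y <= staircase n x + delta.
Proof.
move=> yn yc; elim: n yn => [|n ih] yn.
  rewrite /staircase big_ord0 add0r (le_trans yn)// mul0r; exact: ltW.
have mono : staircase n x <= staircase n.+1 x.
  by rewrite /staircase big_ord_recr/= lerDl mulr_ge0// ltW.
have [/ih/le_trans|ny] := leP y (n%:R * delta); first by apply; rewrite lerD2r.
suff : staircase n x = n%:R * delta.
  move=> e; apply: le_trans yn _; rewrite -natr1 mulrDl mul1r lerD2r -e//.
rewrite /staircase (eq_bigr (fun=> delta)).
  by rewrite sumr_const card_ord mulr_natl.
move=> k _; rewrite indicE mem_set ?mulr1//=.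
apply: lt_le_trans yc; rewrite lte_fin; apply: le_lt_trans ny.
by rewrite ler_pM2r// ler_nat.
Qed.

Lemma measurable_staircase n : measurable_fun setT (EFin \o staircase n).
Proof.
apply/measurable_EFinP; apply: measurable_sum => k.
by apply: measurable_funM => //; apply: measurable_indic; exact: mc.
Qed.

Lemma integral_staircase (P : probability T R) n :
  (\int[P]_x (staircase n x)%:E =
   (\sum_(k < n) delta * fine (P (level k)))%:E)%E.
Proof.
under eq_integral do rewrite /staircase -sumEFin.
rewrite ge0_integral_sum//; last 2 first.
- move=> k; apply/measurable_EFinP; apply: measurable_funM => //.
  by apply: measurable_indic; exact: mc.
- by move=> k x _; rewrite lee_fin mulr_ge0// ltW.
rewrite -sumEFin; apply: eq_bigr => k _.
under eq_integral do rewrite EFinM.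
rewrite ge0_integralZl//; last 2 first.
- by apply/measurable_EFinP/measurable_indic; exact: mc.
- by rewrite lee_fin ltW.
rewrite integral_indic//; last exact: mc.
rewrite setIT EFinM fineK//; apply: fin_num_measure; exact: mc.
Qed.

End staircase.

Import HBNNSimple.

(** A simple function below [c] with integral above [t] is bounded, hence dominated up to [delta] by
    a staircase with finitely many steps. The integral of the staircase is a finite positive
    combination of measures of superlevel sets, and these are controlled in the limit. *)
Lemma integral_lower_semicontinuous d (T : measurableType d) (R : realType)
    (c : T -> \bar R) (I : Type) (F : set_system I)
    (P_ : I -> probability T R) (P : probability T R) (t : R) :
  UltraFilter F -> (forall x, (0 <= c x)%E) ->
  (forall a : R, measurable [set x | (a%:E < c x)%E]) ->
  (forall a : R, (P [set x | (a%:E < c x)%E] <=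
    (lim (fine (P_ i [set x | (a%:E < c x)%E]) @[i --> F]))%:E)%E) ->
  (t%:E < \int[P]_x c x)%E -> \forall i \near F, (t%:E < \int[P_ i]_x c x)%E.
Proof.
move=> FU c_ge0 mc Pc; rewrite ge0_integralTE// => /ereal_sup_gt.
move=> [_ [h /= hc <-]] th.
have [M hM] : exists M : R, forall x, h x <= M.
  have [M [_ hM]] := simple_bounded h.
  by exists (M + 1) => x; rewrite (le_trans (ler_norm _))// hM//= ltrDl.
have [r tr rh] : exists2 r : R, t < r & (r%:E < sintegral P h)%E.
  move: th; case: (sintegral P h) => [u||]//=.
    rewrite lte_fin => tu; exists ((t + u) / 2); first by rewrite midf_lt.
    by rewrite lte_fin midf_lt.
  by move=> _; exists (t + 1); rewrite ?ltrDl// ltry.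
(* The step equals the gap between [r] and [t], so losing [delta] in the integral still leaves more
   than [t]. *)
pose delta := r - t.
have d0 : 0 < delta by rewrite subr_gt0.
have [n Mn] : exists n : nat, M <= n%:R * delta.
  exists (Num.trunc (`|M| / delta)).+1.
  rewrite -ler_pdivrMr// (le_trans _ (ltW (truncnS_gt _)))//.
  by rewrite ler_pM2r ?invr_gt0// ler_norm.
have tg : (t%:E < \int[P]_x (staircase c delta n x)%:E)%E.
  rewrite -(@lteD2rE _ delta%:E)//.
  rewrite -EFinD {1}/delta addrC subrK; apply: (lt_le_trans rh).
  rewrite -integralT_nnsfun.
  have -> : delta%:E = (\int[P]_x delta%:E)%E.
    by rewrite integral_cst// [X in (_ * X)%E]probability_setT mule1.
  rewrite -ge0_integralD//; last 3 first.
  - by move=> x _; rewrite lee_fin staircase_ge0.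
  - exact: measurable_staircase.
  - by move=> x _; rewrite lee_fin ltW.
  apply: ge0_le_integral => //.
  - by move=> x _; rewrite lee_fin.
  - exact/measurable_EFinP.
  - by apply: emeasurable_funD => //; exact: measurable_staircase.
  - move=> x _; rewrite -EFinD lee_fin.
    by apply: le_staircase => //; exact: le_trans (hM x) Mn.
pose p k i := fine (P_ i [set x | ((k.+1%:R * delta)%:E < c x)%E]).
have fin k i : P_ i [set x | ((k.+1%:R * delta)%:E < c x)%E] \is a fin_num.
  by apply: fin_num_measure; exact: mc.
have cvp k : p k @ F --> lim (p k @ F).
  apply: (@ultra_bounded_cvg _ _ _ _ 0 1) => i; rewrite /p fine_ge0//=.
  by rewrite -lee_fin fineK//; apply: probability_le1; exact: mc.
have cvs : (fun i => \sum_(k < n) delta * p k i) @ F -->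
    \sum_(k < n) delta * lim (p k @ F).
  apply: cvg_big => [|k _]; first exact: add_continuous.
  by apply: cvgMl_tmp; exact: cvp.
have ts : t < \sum_(k < n) delta * lim (p k @ F).
  rewrite -lte_fin; apply: lt_le_trans tg _.
  rewrite integral_staircase// lee_fin; apply: ler_sum => k _.
  rewrite ler_pM2l// -lee_fin fineK; first exact: Pc.
  by apply: fin_num_measure; exact: mc.
have : \forall i \near F, t < \sum_(k < n) delta * p k i.
  exact: cvgr_gt cvs _ ts.
apply: (@filterS _ F) => i; rewrite -lte_fin => /lt_le_trans; apply.
rewrite -integral_staircase//; apply: ge0_le_integral => //.
- by move=> x _; rewrite lee_fin staircase_ge0.
- exact: measurable_staircase.
- exact: measurable_fun_superlevel.
- by move=> x _; exact: staircase_le.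
Qed.

(** This form lets two lower semicontinuous terms be bounded separately by strict real lower bounds,
    without assuming either term finite. *)
Lemma adde_le_of_lt (R : realType) (a b : \bar R) (z : R) :
  (0 <= a)%E -> (0 <= b)%E ->
  (forall s t : R, (s%:E < a)%E -> (t%:E < b)%E -> s + t <= z) ->
  (a + b <= z%:E)%E.
Proof.
move=> a0 b0 h.
have below (x : \bar R) : (0 <= x)%E -> ((-1)%:E < x)%E.
  by apply: lt_le_trans; rewrite lte_fin ltrN10.
case: a a0 h => [a||] //= a0 h; last first.
  (* If [a] is infinite, the admissible bounds [z + 2] and -1 add up to more than [z]. *)
  by exfalso; move: (h (z + 2) (-1) (ltry _) (below _ b0)); lra.
case: b b0 h => [b||] //= b0 h; last first.
  by exfalso; move: (h (-1) (z + 2) (below _ a0) (ltry _)); lra.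
rewrite -EFinD lee_fin; apply/ler_addgt0Pr => e e0.
have := h (a - e / 2) (b - e / 2); rewrite !lte_fin !gtrBl.
by rewrite divr_gt0// => /(_ isT isT); clear; lra.
Qed.

Lemma exists_mixture d (T : measurableType d) (R : realType)
    (P1 P2 : probability T R) (t : R) : 0 <= t <= 1 ->
  exists Q : probability T R,
    (forall A, Q A = t%:E * P1 A + (1 - t)%:E * P2 A)%E /\
    (forall f : T -> \bar R, (forall x, 0 <= f x)%E -> measurable_fun setT f ->
      \int[Q]_x f x = t%:E * \int[P1]_x f x + (1 - t)%:E * \int[P2]_x f x)%E.
Proof.
move=> /andP[t0]; rewrite -subr_ge0 => t1.
pose m := measure_add (mscale (NngNum t0) P1) (mscale (NngNum t1) P2).
have mE A : m A = (t%:E * P1 A + (1 - t)%:E * P2 A)%E.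
  by rewrite /m measure_addE.
have m1 : m setT = 1%E.
  rewrite mE [P1 _]probability_setT [P2 _]probability_setT !mule1 -EFinD.
  by rewrite addrC subrK.
pose Q : probability T R := HB.pack (m : set T -> \bar R) (Measure.on m)
  (Measure_isProbability.Build d T R m m1).
exists Q; split; first exact: mE.
move=> f f0 mf.
rewrite [LHS](_ : _ = \int[m]_x f x)%E//.
by rewrite ge0_integral_measure_add// !ge0_integral_mscale.
Qed.

(** * Minimizers *)

Section minimizers.
Context {R : realType} {X : completePseudoMetricType R}.
Variables (D : wprob X -> wprob X -> \bar R) (c : X * X -> \bar R).
Hypothesis pX : polish X.
Hypothesis preD : pre_divergence D.
Hypothesis costc : cost_function c.

Lemma cost_ge0 z : (0 <= c z)%E. Proof. by case: costc. Qed.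

Lemma cost_level (a : R) :
  measurable ([set z | (a%:E < c z)%E] : set (borelX X * borelX X)).
Proof.
apply: open_measurable_prod => //; apply: (lower_semicontinuousP c).1.
by case: costc.
Qed.

Lemma measurable_cost :
  measurable_fun setT (c : borelX X * borelX X -> \bar R).
Proof. exact: measurable_fun_superlevel cost_level. Qed.

Lemma OTcost_ge0 (P nu : wprob X) : (0 <= OTcost c P nu)%E.
Proof.
apply: le_ereal_inf_tmp => _ [pi _ <-].
by apply: integral_ge0 => z _; exact: cost_ge0.
Qed.

Lemma OTcost_le (P nu : wprob X) pi :
  coupling P nu pi -> (OTcost c P nu <= \int[pi]_z c z)%E.
Proof. by move=> cpl; apply: ereal_inf_lbound; exists pi. Qed.

Lemma Dc_le (mu nu eta : wprob X) :
  (Dc D c nu mu <= D eta mu + OTcost c eta nu)%E.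
Proof. by apply: ereal_inf_lbound; exists eta. Qed.

Lemma Dc_ge0 (mu nu : wprob X) : (0 <= Dc D c nu mu)%E.
Proof.
apply: le_ereal_inf_tmp => _ [eta _ <-].
apply: adde_ge0; last exact: OTcost_ge0.
by case: preD.
Qed.

(** The two nested infima are resolved in turn; [D eta mu] is finite for the chosen [eta], so it can
    be subtracted before a coupling is picked. *)
Lemma near_minimizer (mu nu : wprob X) (r : R) : (Dc D c nu mu < r%:E)%E ->
  exists eta pi, coupling eta nu pi /\
    (D eta mu + \int[pi]_z c z < r%:E)%E.
Proof.
move=> /ereal_inf_lt[_ [eta _ <-]] etar.
have D0 : (0 <= D eta mu)%E by case: preD.
have Dfin : D eta mu \is a fin_num.
  rewrite ge0_fin_numE//; apply: le_lt_trans (ltry r); apply: ltW.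
  by apply: le_lt_trans etar; rewrite leeDl// OTcost_ge0.
move: etar; rewrite -lteBrDl// => /ereal_inf_lt[_ [pi cpl <-]].
by rewrite lteBrDl// => h; exists eta, pi.
Qed.

Lemma exists_minimizer (mu nu : wprob X) :
  lower_semicontinuous (fun P : wprob X => D P mu) ->
  (forall M : R, compact [set P : wprob X | (D P mu <= M%:E)%E]) ->
  exists eta : wprob X, Dc D c nu mu = (D eta mu + OTcost c eta nu)%E.
Proof.
move=> lscD cptD.
have [Dy|Dfin] := eqVneq (Dc D c nu mu) +oo%E.
  (* When the infimum is infinite every measure attains it, [mu] in particular. *)
  by exists mu; apply/eqP; rewrite eq_le Dc_le Dy leey.
have {}Dfin : Dc D c nu mu \is a fin_num.
  by rewrite ge0_fin_numE ?Dc_ge0// ltey.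
set d := fine (Dc D c nu mu).
have dE : Dc D c nu mu = d%:E by rewrite fineK.
pose J := {z : wprob X * probability (borelX X * borelX X)%type R |
  coupling z.1 nu z.2}.
pose val_ (z : J) : \bar R := (D (sval z).1 mu + \int[(sval z).2]_x c x)%E.
(* The sets of [e]-optimal pairs form a filter base; an ultrafilter above it takes the place of a
   minimizing sequence. *)
pose G : set_system J := filter_from [set e : R | 0 < e]
  (fun e => [set z | (val_ z < (d + e)%:E)%E]).
have PG : ProperFilter G.
  apply: filter_from_proper.
    apply: filter_from_filter; first by exists 1; exact: ltr01.
    move=> i j i0 j0; exists (Num.min i j).
      by rewrite /= lt_min; apply/andP.
    move=> z /= zij; split; apply: (lt_le_trans zij);
      by rewrite lee_fin lerD2l ge_min lexx ?orbT.
  move=> e /= e0; have [|eta [pi [cpl h]]] := @near_minimizer mu nu (d + e).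
    by rewrite dE lte_fin ltrDl.
  by exists (exist _ (eta, pi) cpl).
have [F [FU GF]] := ultraFilterLemma PG.
pose eta (z : J) : wprob X := (sval z).1.
pose pi_ (z : J) := (sval z).2.
have valF e : 0 < e -> \forall z \near F, (val_ z < (d + e)%:E)%E.
  by move=> e0; apply: GF; exists e.
have int_ge0 z : (0 <= \int[pi_ z]_x c x)%E.
  by apply: integral_ge0 => x _; exact: cost_ge0.
have D_ge0 P : (0 <= D P mu)%E by case: preD.
(* Costs are nonnegative, so a pair whose value is below [d + 1] has its [eta] in this compact
   sublevel set. *)
have := cptD (d + 1); rewrite compact_ultra.
move=> /(_ (eta @ F) (ultra_fmap eta FU)).
case=> [|P [_ etaP]].
  apply: (@filterS _ F) (valF 1 ltr01) => z /ltW; apply: le_trans.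
  by rewrite /val_ leeDl//; exact: int_ge0.
have [pi cpl piU] := limit_coupling FU pX (fun z : J => svalP z) etaP.
exists P; apply/eqP; rewrite eq_le Dc_le/= dE.
apply: (@le_trans _ _ (D P mu + \int[pi]_x c x)%E).
  by rewrite leeD2l// OTcost_le.
apply: adde_le_of_lt => //.
  by apply: integral_ge0 => x _; exact: cost_ge0.
move=> s t sP tpi; apply/ler_addgt0Pr => e e0.
have nD : \forall z \near F, (s%:E < D (eta z) mu)%E.
  have [V PV hV] := lscD _ _ sP.
  by apply: (@filterS _ F) (etaP _ PV) => z /hV.
have nI : \forall z \near F, (t%:E < \int[pi_ z]_x c x)%E.
  apply: integral_lower_semicontinuous tpi => //.
  - exact: cost_ge0.
  - exact: cost_level.
  - by move=> a; apply: piU; apply: (lower_semicontinuousP c).1; case: costc.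
(* A single pair satisfies both lower bounds and is [e]-optimal, which gives [s + t <= d + e]. *)
have [z [[zD zI] zv]] := filter_ex (filterI (filterI nD nI) (valF e e0)).
rewrite -lee_fin EFinD; apply: le_trans (ltW zv).
by apply: leeD; exact: ltW.
Qed.

(** The mixture of two [e]-optimal couplings has first marginal [Q] and, the weights adding up to 1,
    second marginal [nu]; its cost is the mixture of their costs. *)
Lemma OTcost_mixture (P1 P2 Q nu : wprob X) (t : R) : 0 <= t <= 1 ->
  is_mixture t P1 P2 Q ->
  (OTcost c P1 nu < +oo)%E -> (OTcost c P2 nu < +oo)%E ->
  (OTcost c Q nu <= t%:E * OTcost c P1 nu + (1 - t)%:E * OTcost c P2 nu)%E.
Proof.
move=> t01 mixQ.
rewrite -!ge0_fin_numE ?OTcost_ge0// => fin1 fin2.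
apply/lee_addgt0Pr => e e0.
have [_ [pi1 cpl1 <-] /ltW h1] := lb_ereal_inf_adherent e0 fin1.
have [_ [pi2 cpl2 <-] /ltW h2] := lb_ereal_inf_adherent e0 fin2.
have [pi [piE int_pi]] := exists_mixture pi1 pi2 t01.
have cpl : coupling Q nu pi.
  split=> A mA; rewrite piE.
    by rewrite cpl1.1// cpl2.1// mixQ.
  rewrite cpl1.2// cpl2.2// -muleDl//; last exact: fin_num_measure.
  by rewrite -EFinD addrC subrK mul1e.
apply: le_trans (OTcost_le cpl) _.
rewrite int_pi//; [|exact: cost_ge0|exact: measurable_cost].
have /andP[t0 t1] := t01.
have t1' : 0 <= 1 - t by rewrite subr_ge0.
apply: (@le_trans _ _ (t%:E * (OTcost c P1 nu + e%:E) +
  (1 - t)%:E * (OTcost c P2 nu + e%:E))%E).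
  by apply: leeD; apply: lee_wpmul2l.
case: (OTcost c P1 nu) fin1 => [a||]// _.
case: (OTcost c P2 nu) fin2 => [b||]// _.
change ((t * (a + e) + (1 - t) * (b + e))%:E <=
  (t * a + (1 - t) * b + e)%:E)%E.
by rewrite lee_fin; lra.
Qed.

Lemma minimizer_unique (mu nu eta1 eta2 : wprob X) :
  strictly_convex_on_finite (fun P : wprob X => D P mu) ->
  (Dc D c nu mu < +oo)%E ->
  Dc D c nu mu = (D eta1 mu + OTcost c eta1 nu)%E ->
  Dc D c nu mu = (D eta2 mu + OTcost c eta2 nu)%E ->
  same_measure eta1 eta2.
Proof.
move=> convD Dfin Dc1 Dc2; apply: contrapT => ne.
have D_ge0 P : (0 <= D P mu)%E by case: preD.
have fins eta : Dc D c nu mu = (D eta mu + OTcost c eta nu)%E ->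
    (D eta mu < +oo)%E /\ (OTcost c eta nu < +oo)%E.
  move=> h; split; apply: le_lt_trans Dfin; rewrite h.
    by rewrite leeDl// OTcost_ge0.
  by rewrite leeDr.
have [D1 O1] := fins _ Dc1; have [D2 O2] := fins _ Dc2.
have h01 : 0 <= (2^-1 : R) <= 1 by apply/andP; split; lra.
have [Q [QE _]] := exists_mixture eta1 eta2 h01.
have mixQ : is_mixture 2^-1 eta1 eta2 Q by move=> A _; exact: QE.
have ltD : (D Q mu < (2^-1)%:E * D eta1 mu + (1 - 2^-1)%:E * D eta2 mu)%E.
  by apply: convD mixQ => //; apply/andP; split; lra.
have leO := OTcost_mixture h01 mixQ O1 O2.
have := Dc_le mu nu Q; apply/negP; rewrite -ltNge.
(* Adding a strict and a weak inequality keeps strictness because the transport cost of [Q] is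
   finite, as convexity shows. *)
apply: lt_le_trans (lte_leD _ ltD leO) _.
  rewrite ge0_fin_numE ?OTcost_ge0//; apply: le_lt_trans leO _.
  by apply: lte_add_pinfty; apply: lte_mul_pinfty; rewrite ?lee_fin//; lra.
(* Both minimizers have the same finite value, so the average of their values equals
   [Dc D c nu mu]. *)
rewrite le_eqVlt; apply/orP; left; apply/eqP.
have dE eta : Dc D c nu mu = (D eta mu + OTcost c eta nu)%E ->
    (D eta mu < +oo)%E -> (OTcost c eta nu < +oo)%E ->
    exists a b, [/\ D eta mu = a%:E, OTcost c eta nu = b%:E &
      Dc D c nu mu = (a + b)%:E].
  move=> h Da Ob; exists (fine (D eta mu)), (fine (OTcost c eta nu)).
  by rewrite EFinD !fineK ?ge0_fin_numE ?OTcost_ge0.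
have [a1 [b1 [-> -> e1]]] := dE _ Dc1 D1 O1.
have [a2 [b2 [-> -> e2]]] := dE _ Dc2 D2 O2.
move: e2; rewrite e1 => -[e12].
by rewrite -!EFinM -!EFinD; congr EFin; lra.
Qed.

End minimizers.

Theorem theorem2 (R : realType) (X : completePseudoMetricType R)
  (D : wprob X -> wprob X -> \bar R) (c : X * X -> \bar R) (mu nu : wprob X) :
  polish X -> pre_divergence D -> cost_function c ->
  lower_semicontinuous (fun P : wprob X => D P mu) ->
  (forall M : R, compact [set P : wprob X | (D P mu <= M%:E)%E]) ->
  (exists eta : wprob X, Dc D c nu mu = (D eta mu + OTcost c eta nu)%E) /\
  (strictly_convex_on_finite (fun P : wprob X => D P mu) ->
   (Dc D c nu mu < +oo)%E ->
   forall eta1 eta2 : wprob X,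
     Dc D c nu mu = (D eta1 mu + OTcost c eta1 nu)%E ->
     Dc D c nu mu = (D eta2 mu + OTcost c eta2 nu)%E ->
     same_measure eta1 eta2).
Proof.
move=> pX preD costc lscD cptD; split; first exact: exists_minimizer.
by move=> convD Dfin eta1 eta2; exact: minimizer_unique.
Qed.
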